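(* Let $\mathcal{F}$ be the folded component and $\mathcal{T}$ a stacked component (the vertex-disjoint graphs specified in the context). If the new edge $\mathcal{E}=\{v_1,v_2\}$ joins a floor vertex $v_1\in V(\mathcal{F})$ to a floor vertex $v_2\in V(\mathcal{T})$, then $$\tfrac34(\mathrm{ord}(\ell)+5)\ \le\ \mathrm{diam}(\mathcal{F}+\mathcal{E}+\mathcal{T})\ \le\ \mathrm{ord}(\ell)+3,$$ where $\mathcal{F}+\mathcal{E}+\mathcal{T}$ is the disjoint union of $\mathcal{F}$ and $\mathcal{T}$ together with the edge $\mathcal{E}$.
   Context: Let $p$ be a prime with $p\equiv 71$ or $119\pmod{120}$, let $\ell=2$, and let $L=\mathrm{ord}(\ell)$ be the order, in the ideal class group of $\mathbb{Q}(\sqrt{-p})$, of a prime ideal above $2$; it is an odd integer $\ge 3$. The folded and stacked components are the components of the supersingular $2$-isogeny graph over $\mathbb{F}_p$ after identifying curves up to $\overline{\mathbb{F}_p}$-isomorphism, regarded as simple undirected graphs. The folded component $\mathcal{F}$ is labelled so that $V(\mathcal{F})=\{0,1,\dots,L-1\}$ and $$E(\mathcal{F})=\{\{2k-1,2k+1\}: 1\le k\le \tfrac12(L-3)\}\cup\{\{2k+1,2k+2\}:0\le k\le \tfrac12(L-3)\}\cup\{\{0,1\}\};$$ its floor vertices are the nonzero even vertices. A stacked component $\mathcal{T}$ is labelled so that $V(\mathcal{T})=\{0,1,\dots,2L-1\}$ and $$E(\mathcal{T})=\{\{2i,2i+1\}:0\le i\le L-1\}\cup\{\{2i+1,2i+3\}:0\le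 i\le L-2\}\cup\{\{2L-1,1\}\};$$ its floor vertices are the even vertices. (The vertex sets are regarded as disjoint.) The new edge $\mathcal{E}$ is the single edge coming from $2$-isogenies not defined over $\mathbb{F}_p$ that must be added to obtain the spine; its endpoints are always two distinct floor vertices. The diameter is the maximum graph distance between two vertices. *)

(* Defs.v *)
From mathcomp Require Import all_boot all_order all_algebra all_field.
Set Implicit Arguments.
Unset Strict Implicit.
Unset Printing Implicit Defensive.

Import Order.TTheory GRing.Theory Num.Theory.
Local Open Scope ring_scope.

(* Q(sqrt(-p)) and its maximal order, as subsets of the algebraic numbers. *)
Definition quad_field (p : nat) (x : algC) : Prop :=
  exists a b : rat, x = ratr a + ratr b * sqrtC (- p%:R).

Definition quad_int (p : nat) (x : algC) : Prop :=
  quad_field p x /\ x \in Aint.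

Definition is_ideal (p : nat) (I : algC -> Prop) : Prop :=
  [/\ forall x, I x -> quad_int p x,
      I 0,
      forall x y, I x -> I y -> I (x + y)
    & forall a x, quad_int p a -> I x -> I (a * x)].

Definition is_prime_ideal (p : nat) (I : algC -> Prop) : Prop :=
  [/\ is_ideal p I,
      ~ I 1
    & forall a b, quad_int p a -> quad_int p b -> I (a * b) -> I a \/ I b].

Definition ideal_mul (I J : algC -> Prop) (x : algC) : Prop :=
  exists (n : nat) (a b : 'I_n -> algC),
    [/\ forall i, I (a i), forall i, J (b i) & x = \sum_(i < n) a i * b i].

Definition ideal_exp (p : nat) (I : algC -> Prop) (n : nat) : algC -> Prop :=
  iter n (ideal_mul I) (quad_int p).

(* I and J have the same class iff a I = b J for some nonzero integers a, b of
   the field. *)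
Definition ideal_class_eq (p : nat) (I J : algC -> Prop) : Prop :=
  exists a b : algC,
    [/\ quad_int p a /\ a <> 0,
        quad_int p b /\ b <> 0
      & forall x, (exists2 y, I y & x = a * y) <-> (exists2 z, J z & x = b * z)].

(* n is the order of the class of I in the ideal class group. *)
Definition is_class_order (p : nat) (I : algC -> Prop) (n : nat) : Prop :=
  [/\ (0 < n)%N,
      ideal_class_eq p (ideal_exp p I n) (quad_int p)
    & forall m, (0 < m)%N ->
        ideal_class_eq p (ideal_exp p I m) (quad_int p) -> (n <= m)%N].

Local Close Scope ring_scope.

(* A simple graph on T is given by its edge set, a set of unordered pairs. *)
Definition adj (T : finType) (E : {set {set T}}) : rel T :=
  fun x y => (x != y) && ([set x; y] \in E).

(* Length of a shortest walk from x to y; it is #|T| (a value that no shortest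
   walk can have) when x and y are not connected. *)
Definition dist (T : finType) (E : {set {set T}}) (x y : T) : nat :=
  find (fun n => [exists t : n.-tuple T, path (adj E) x t && (last x t == y)])
       (iota 0 #|T|).

Definition diam (T : finType) (E : {set {set T}}) : nat :=
  \max_(x : T) \max_(y : T) dist E x y.

Definition edges_of (n : nat) (r : rel nat) : {set {set 'I_n}} :=
  [set e | [exists x : 'I_n, exists y : 'I_n, r x y && (e == [set x; y])]].

Definition folded_edges (L : nat) : {set {set 'I_L}} :=
  edges_of L (fun x y =>
    [|| [exists k : 'I_L,
          [&& 1 <= k, k <= (L - 3)./2, x == 2 * k - 1 & y == 2 * k + 1]],
        [exists k : 'I_L,
          [&& k <= (L - 3)./2, x == 2 * k + 1 & y == 2 * k + 2]]
      | (x == 0) && (y == 1)]).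

Definition folded_floor (L : nat) (v : 'I_L) : bool :=
  (v != 0 :> nat) && ~~ odd v.

Definition stacked_edges (L : nat) : {set {set 'I_(2 * L)}} :=
  edges_of (2 * L) (fun x y =>
    [|| [exists i : 'I_L, (x == 2 * i) && (y == 2 * i + 1)],
        [exists i : 'I_L,
          [&& i <= L - 2, x == 2 * i + 1 & y == 2 * i + 3]]
      | (x == 2 * L - 1) && (y == 1)]).

Definition stacked_floor (L : nat) (v : 'I_(2 * L)) : bool := ~~ odd v.

(* Edge set, on the disjoint union of T1 and T2, of the disjoint union of the
   two graphs together with the edge {v1, v2}. *)
Definition join_edges (T1 T2 : finType)
    (E1 : {set {set T1}}) (E2 : {set {set T2}}) (v1 : T1) (v2 : T2) :
    {set {set T1 + T2}} :=
  [set (inl @: e : {set T1 + T2}) | e : {set T1} in E1]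
  :|: [set (inr @: e : {set T1 + T2}) | e : {set T2} in E2]
  :|: [set [set inl v1; inr v2]].

(* Main.v *)
(** Let [L = ord(2)]. The labelled folded component has the expected shape only
for odd [L], and oddness is the [2]-part of genus theory for a prime
discriminant: with [p = 8 c - 1] and [P = (2, theta)], [theta ^ 2 = theta - 2 c],
a generator of [P ^ (2 m)] is not divisible by [2] and yields odd [a], [b] with
[a ^ 2 + p b ^ 2 = 2 ^ (2 m + 2)]. The coprime factors of
[(2 ^ (m + 1) - a) (2 ^ (m + 1) + a) = p b ^ 2] are [s ^ 2] and [p r ^ 2], so
[s ^ 2 + p r ^ 2 = 2 ^ (m + 2)] and [P ^ m] is already principal.

Write [L = 2 n + 1]. Every vertex is within [1] of the spine, which is a path
with [n] vertices in the folded component and an [L]-cycle in the stacked one;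
hence the diameters of the components are at most [n + 1] and [n + 2], which
gives the upper bound. A floor vertex has eccentricity exactly [n + 2] in the
stacked component and at least [(n + 3) / 2] in the folded one, which gives
the lower bound; distances are bounded below by [1]-Lipschitz functions. *)

Require Import Defs.
From mathcomp Require Import all_boot all_order all_algebra all_field.
From mathcomp Require Import ring zify.
Set Implicit Arguments.
Unset Strict Implicit.
Unset Printing Implicit Defensive.

Import Order.TTheory GRing.Theory Num.Theory.

(** * Walks, distance and diameter *)

Definition reach (T : finType) (E : {set {set T}}) (n : nat) (x y : T) : Prop :=
  exists s, [/\ path (adj E) x s, last x s = y & size s <= n].

Lemma adj_sym (T : finType) (E : {set {set T}}) : symmetric (adj E).
Proof. by move=> x y; rewrite /adj eq_sym setUC. Qed.

Lemma reach0 (T : finType) (E : {set {set T}}) n x : reach E n x x.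
Proof. by exists [::]. Qed.

Lemma reach_adj (T : finType) (E : {set {set T}}) x y : adj E x y -> reach E 1 x y.
Proof. by move=> xy; exists [:: y]; rewrite /= xy. Qed.

Lemma reach_trans (T : finType) (E : {set {set T}}) m n x y z :
  reach E m x y -> reach E n y z -> reach E (m + n) x z.
Proof.
move=> [s [ps <- sm]] [t [pt <- tn]]; exists (s ++ t).
by rewrite cat_path ps pt last_cat size_cat leq_add.
Qed.

Lemma reach_sym (T : finType) (E : {set {set T}}) n x y :
  reach E n x y -> reach E n y x.
Proof.
move=> [s [ps <- sn]]; exists (rev (belast x s)).
rewrite rev_path (eq_path (e' := adj E)); last by move=> u v; rewrite adj_sym.
rewrite ps size_rev size_belast sn; split=> //.
by case: s {ps sn} => //= a s; rewrite rev_cons last_rcons.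
Qed.

Lemma reach_leq (T : finType) (E : {set {set T}}) m n x y :
  m <= n -> reach E m x y -> reach E n x y.
Proof. by move=> mn [s [ps ls sm]]; exists s; rewrite (leq_trans sm). Qed.

Lemma dist_le (T : finType) (E : {set {set T}}) n x y :
  n < #|T| -> reach E n x y -> dist E x y <= n.
Proof.
move=> nT [s [ps ls sn]]; apply: leq_trans sn; rewrite leqNgt; apply/negP => lt.
have sT : size s < #|T|.
  by apply: leq_trans lt _; rewrite -[leqRHS](size_iota 0) find_size.
have := before_find 0 lt; rewrite nth_iota // add0n => /negbT/existsPn.
by move=> /(_ (in_tuple s)); rewrite ps ls eqxx.
Qed.

(** Along a walk [h] gains at most one per edge. The second hypothesis covers the default value
    [#|T|] of [dist] when no walk exists. *)
Lemma dist_ge (T : finType) (E : {set {set T}}) (h : T -> nat) x y :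
  (forall u v, adj E u v -> h v <= (h u).+1) ->
  h y <= h x + #|T| -> h y <= h x + dist E x y.
Proof.
move=> hE hT; rewrite /dist; set a := (X in find X _).
have [has_a|] := boolP (has a (iota 0 #|T|)); last first.
  by move/hasNfind=> ->; rewrite size_iota.
have := nth_find 0 has_a; rewrite nth_iota ?add0n; last first.
  by move: has_a; rewrite has_find size_iota.
move/existsP=> [t /andP[pt /eqP <-]]; rewrite -[X in _ + X](size_tuple t).
move: (tval t) pt => s {t has_a a hT}.
elim: s x => [|z s IH] x /=; first by rewrite addn0.
by move=> /andP[/hE xz /IH zs]; apply: leq_trans zs _; rewrite addnS -addSn leq_add2r.
Qed.

Lemma dist_le_diam (T : finType) (E : {set {set T}}) x y : dist E x y <= diam E.
Proof.
by apply: (bigop.bigmax_sup x) => //; apply: (bigop.bigmax_sup y).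
Qed.

Lemma diam_le (T : finType) (E : {set {set T}}) n :
  (forall x y, dist E x y <= n) -> diam E <= n.
Proof. by move=> dn; apply/bigop.bigmax_leqP => x _; apply/bigop.bigmax_leqP => y _. Qed.

Lemma set2_eq (T : finType) (x y a b : T) :
  [set x; y] = [set a; b] -> x = a /\ y = b \/ x = b /\ y = a.
Proof.
move=> e; have /set2P[xa|xb] : x \in [set a; b] by rewrite -e set21.
- left; split=> //; have /set2P[ya|//] : y \in [set a; b] by rewrite -e set22.
  have /set2P[] : b \in [set x; y] by rewrite e set22.
    by rewrite xa ya.
  by [].
- right; split=> //; have /set2P[//|yb] : y \in [set a; b] by rewrite -e set22.
  have /set2P[] : a \in [set x; y] by rewrite e set21.
    by rewrite xb yb.
  by [].
Qed.

Lemma adj_edges_of n (r : rel nat) (x y : 'I_n) :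
  adj (edges_of n r) x y -> r x y \/ r y x.
Proof.
case/andP=> _; rewrite inE => /existsP[a /existsP[b /andP[rab /eqP]]].
by case/set2_eq=> -[-> ->]; [left | right].
Qed.

Lemma edges_of_adj n (r : rel nat) (x y : 'I_n) :
  x != y -> r x y -> adj (edges_of n r) x y.
Proof.
move=> xy rxy; rewrite /adj xy inE; apply/existsP; exists x; apply/existsP; exists y.
by rewrite rxy eqxx.
Qed.

(** * Adjacency and walks in the joined graph *)

(** An image under [inr] contains no [inl] vertex and the new edge contains [inr v2], so neither can
    join two [inl] vertices. *)
Lemma adj_join_ll (T1 T2 : finType) (E1 : {set {set T1}}) (E2 : {set {set T2}})
    v1 v2 x y : adj (join_edges E1 E2 v1 v2) (inl x) (inl y) = adj E1 x y.
Proof.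
rewrite /adj !inE; congr (_ && _).
have -> : [set inl x; inl y] = inl @: [set x; y] :> {set T1 + T2}.
  by rewrite imsetU !imset_set1.
rewrite mem_imset; last by apply: imset_inj => ? ? [].
case: (_ \in E1) => //=; apply/negbTE/norP; split.
  apply/negP=> /imsetP[e _ /setP /(_ (inl x))]; rewrite imset_f ?inE ?eqxx //.
  by move/esym/imsetP => [].
by apply/eqP => /setP /(_ (inr v2)); rewrite !inE eqxx orbT => /imsetP[].
Qed.

Lemma adj_join_rr (T1 T2 : finType) (E1 : {set {set T1}}) (E2 : {set {set T2}})
    v1 v2 x y : adj (join_edges E1 E2 v1 v2) (inr x) (inr y) = adj E2 x y.
Proof.
rewrite /adj !inE; congr (_ && _).
have -> : [set inr x; inr y] = inr @: [set x; y] :> {set T1 + T2}.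
  by rewrite imsetU !imset_set1.
rewrite [X in _ || X || _]mem_imset; last by apply: imset_inj => ? ? [].
case: (_ \in E2) => //=; rewrite ?orbT // orbF; apply/negbTE/norP; split.
  apply/negP=> /imsetP[e _ /setP /(_ (inr x))]; rewrite imset_f ?inE ?eqxx //.
  by move/esym/imsetP => [].
by apply/eqP => /setP /(_ (inl v1)); rewrite !inE eqxx => /imsetP[].
Qed.

Lemma adj_join_lr (T1 T2 : finType) (E1 : {set {set T1}}) (E2 : {set {set T2}})
    v1 v2 x y :
  adj (join_edges E1 E2 v1 v2) (inl x) (inr y) = (x == v1) && (y == v2).
Proof.
rewrite /adj !inE /=; apply/idP/idP; last first.
  by case/andP=> /eqP -> /eqP ->; rewrite eqxx orbT.
case/orP=> [/orP[]|/eqP].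
- by case/imsetP=> e _ /setP /(_ (inr y)); rewrite !inE eqxx orbT => /esym/imsetP[].
- by case/imsetP=> e _ /setP /(_ (inl x)); rewrite !inE eqxx => /esym/imsetP[].
by case/set2_eq=> -[] // [->] [->]; rewrite !eqxx.
Qed.

Lemma reach_join_l (T1 T2 : finType) (E1 : {set {set T1}}) (E2 : {set {set T2}})
    v1 v2 n x y :
  reach E1 n x y -> reach (join_edges E1 E2 v1 v2) n (inl x) (inl y).
Proof.
move=> [s [ps <- sn]]; exists (map inl s); rewrite last_map size_map; split=> //.
by rewrite path_map (eq_path (e' := adj E1)) // => u v; apply: adj_join_ll.
Qed.

Lemma reach_join_r (T1 T2 : finType) (E1 : {set {set T1}}) (E2 : {set {set T2}})
    v1 v2 n x y :
  reach E2 n x y -> reach (join_edges E1 E2 v1 v2) n (inr x) (inr y).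
Proof.
move=> [s [ps <- sn]]; exists (map inr s); rewrite last_map size_map; split=> //.
by rewrite path_map (eq_path (e' := adj E2)) // => u v; apply: adj_join_rr.
Qed.

Lemma diam_join_le (T1 T2 : finType) (E1 : {set {set T1}}) (E2 : {set {set T2}})
    v1 v2 m n :
  m + n + 1 < #|T1| + #|T2| ->
  (forall x y, reach E1 m x y) -> (forall x y, reach E2 n x y) ->
  diam (join_edges E1 E2 v1 v2) <= m + n + 1.
Proof.
move=> mn r1 r2; apply: diam_le => x y; apply: dist_le; first by rewrite card_sum.
have cross a b : reach (join_edges E1 E2 v1 v2) (m + n + 1) (inl a) (inr b).
  have e : adj (join_edges E1 E2 v1 v2) (inl v1) (inr v2) by rewrite adj_join_lr !eqxx.
  have := reach_trans (reach_join_l E2 v1 v2 (r1 a v1)) (reach_adj e).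
  move/reach_trans=> /(_ _ _ (reach_join_r E1 v1 v2 (r2 v2 b))).
  by apply: reach_leq; rewrite addnAC.
case: x y => [a|a] [b|b].
- by apply: reach_leq (reach_join_l _ _ _ (r1 a b)); rewrite -addnA leq_addr.
- exact: cross.
- exact/reach_sym/cross.
- by apply: reach_leq (reach_join_r _ _ _ (r2 a b)); rewrite addnAC leq_addl.
Qed.

(** * Upper bounds for distances inside each component *)

Lemma folded_edgeP L (x y : 'I_L) :
  adj (folded_edges L) x y ->
  let r a b :=
    [\/ odd a /\ b = a + 2, odd a /\ b = a + 1 | a = 0 /\ b = 1] in
  r x y \/ r y x.
Proof.
move=> + r; have H (a b : nat) : [|| [exists k : 'I_L,
          [&& 1 <= k, k <= (L - 3)./2, a == 2 * k - 1 & b == 2 * k + 1]],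
        [exists k : 'I_L,
          [&& k <= (L - 3)./2, a == 2 * k + 1 & b == 2 * k + 2]]
      | (a == 0) && (b == 1)] -> r a b.
  rewrite /r; case/or3P=> [/existsP[k /and4P[]]|/existsP[k /and3P[]]|].
  - by constructor 1; lia.
  - by constructor 2; lia.
  - by constructor 3; lia.
by move=> /adj_edges_of[] /H; [left|right].
Qed.

Lemma stacked_edgeP L (x y : 'I_(2 * L)) :
  adj (stacked_edges L) x y ->
  let r a b :=
    [\/ ~~ odd a /\ b = a + 1, odd a /\ b = a + 2 | a = 2 * L - 1 /\ b = 1] in
  r x y \/ r y x.
Proof.
move=> + r; have H (a b : nat) :
    [|| [exists i : 'I_L, (a == 2 * i) && (b == 2 * i + 1)],
        [exists i : 'I_L,
          [&& i <= L - 2, a == 2 * i + 1 & b == 2 * i + 3]]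
      | (a == 2 * L - 1) && (b == 1)] -> r a b.
  rewrite /r; case/or3P=> [/existsP[k /andP[]]|/existsP[k /and3P[]]|].
  - by constructor 1; lia.
  - by constructor 2; lia.
  - by constructor 3; lia.
by move=> /adj_edges_of[] /H; [left|right].
Qed.

Lemma folded_reach L n : L = 2 * n + 1 -> forall x y : 'I_L, 0 < n ->
  reach (folded_edges L) (n + 1) x y.
Proof.
move=> Ln x y n0.
have spine d : forall k (a b : 'I_L), a = 2 * k + 1 :> nat ->
    b = 2 * (k + d) + 1 :> nat -> reach (folded_edges L) d a b.
  elim: d => [|d IH] k a b ak bk.
    have -> : a = b by apply: val_inj; rewrite /=; lia.
    exact: reach0.
  have cL : 2 * (k + 1) + 1 < L by case: (b) bk => /= i; lia.
  apply: (@reach_trans _ _ 1 d _ (Ordinal cL)).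
    apply/reach_adj/edges_of_adj; first by apply/eqP => /(congr1 val) /=; lia.
    apply/orP; left; apply/existsP.
    have kL : k + 1 < L by lia.
    exists (Ordinal kL) => /=; case: (b) bk; lia.
  by apply: (IH (k + 1)) => //=; lia.
(* Vertex 0 hangs off spine vertex 1, and any other even [a] off [a - 1]. *)
have foot (a : 'I_L) : exists (k : nat) (b : 'I_L),
    [/\ k < n, b = 2 * k + 1 :> nat & reach (folded_edges L) 1 a b].
  have aL := ltn_ord a; have [oa|ea] := boolP (odd a).
    by exists a./2, a; split; [lia|lia|exact: reach0].
  have [a0|a0] := eqVneq (nat_of_ord a) 0.
    have L1 : 1 < L by lia.
    exists 0, (Ordinal L1); split=> //; apply/reach_adj/edges_of_adj.
      by apply/eqP => /(congr1 val) /=; lia.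
    by apply/orP; right; apply/orP; right; rewrite a0.
  have pL : a.-1 < L by lia.
  exists (a.-1)./2, (Ordinal pL); split=> /=; [lia|lia|].
  apply/reach_sym/reach_adj/edges_of_adj.
    by apply/eqP => /(congr1 val) /=; lia.
  apply/orP; right; apply/orP; left; apply/existsP.
  have kL : (a.-1)./2 < L by lia.
  exists (Ordinal kL) => /=; lia.
have [k [a [kn ak ra]]] := foot x; have [j [b [jn bj rb]]] := foot y.
have rab : reach (folded_edges L) (n - 1) a b.
  have [kj|jk] := leqP k j.
    by apply: (@reach_leq _ _ (j - k)); [lia|apply: (spine _ k); lia].
  apply: reach_sym.
  by apply: (@reach_leq _ _ (k - j)); [lia|apply: (spine _ j); lia].
apply: reach_leq (reach_trans ra (reach_trans rab (reach_sym rb))); lia.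
Qed.

Lemma stacked_reach L n : L = 2 * n + 1 -> forall x y : 'I_(2 * L), 0 < n ->
  reach (stacked_edges L) (n + 2) x y.
Proof.
move=> Ln x y n0.
have step (a b : 'I_(2 * L)) : odd a -> b = a + 2 :> nat
    \/ a = 2 * L - 1 :> nat /\ b = 1 :> nat ->
    reach (stacked_edges L) 1 a b.
  move=> oa ab; apply/reach_adj/edges_of_adj.
    by apply/eqP => /(congr1 val) /=; lia.
  case: ab => [ab|[-> ->]]; last by rewrite eqxx !orbT.
  apply/orP; right; apply/orP; left; apply/existsP.
  have kL : a./2 < L by case: (b) ab => /= i; lia.
  by exists (Ordinal kL) => /=; case: (b) ab => /= i; lia.
(* The alternative with [b + 2 * L] is a walk that passes once from [2 * L - 1] to 1. *)
have spine d : forall k (a b : 'I_(2 * L)), a = 2 * k + 1 :> nat ->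
    b = 2 * (k + d) + 1 :> nat \/ b + 2 * L = 2 * (k + d) + 1 ->
    reach (stacked_edges L) d a b.
  elim: d => [|d IH] k a b ak bk.
    have -> : a = b by apply: val_inj; case: a ak; case: b bk => /=; lia.
    exact: reach0.
  have := ltn_ord a; have := ltn_ord b => bL aL.
  have [kL|kL] := ltnP (2 * (k + 1) + 1) (2 * L).
    apply: (@reach_trans _ _ 1 d _ (Ordinal kL)).
      by apply: step; rewrite /=; lia.
    by apply: (IH (k + 1)) => //=; lia.
  have L1 : 1 < 2 * L by lia.
  apply: (@reach_trans _ _ 1 d _ (Ordinal L1)).
    by apply: step; rewrite /=; lia.
  by apply: (IH 0) => //=; lia.
have foot (a : 'I_(2 * L)) : exists (k : nat) (b : 'I_(2 * L)),
    [/\ k < L, b = 2 * k + 1 :> nat & reach (stacked_edges L) 1 a b].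
  have aL := ltn_ord a; have [oa|ea] := boolP (odd a).
    by exists a./2, a; split; [lia|lia|exact: reach0].
  have a1L : a.+1 < 2 * L by lia.
  exists a./2, (Ordinal a1L); split=> /=; [lia|lia|].
  apply/reach_adj/edges_of_adj.
    by apply/eqP => /(congr1 val) /=; lia.
  apply/orP; left; apply/existsP.
  have kL : a./2 < L by lia.
  exists (Ordinal kL) => /=; lia.
have [k [a [kn ak ra]]] := foot x; have [j [b [jn bj rb]]] := foot y.
have rab : reach (stacked_edges L) n a b.
  wlog kj : k j a b ak bj kn jn {ra rb} / k <= j.
    move=> W; have [|/ltnW] := leqP k j; first exact: W ak bj _ _.
    by move=> jk; apply/reach_sym/(W j k).
  (* On a cycle of length [2 * n + 1] one of the two arcs has length at most [n]. *)
  have [jkn|jkn] := leqP (j - k) n.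
    by apply: (@reach_leq _ _ (j - k)) => //; apply: (spine _ k); lia.
  apply: reach_sym; apply: (@reach_leq _ _ (k + L - j)); first lia.
  by apply: (spine _ j); lia.
apply: reach_leq (reach_trans ra (reach_trans rab (reach_sym rb))); lia.
Qed.

(** * Descent for [a ^ 2 + p b ^ 2] equal to a power of 4 *)

(** The root is [gcdn u b]: its square is the gcd of [u ^ 2], [u b] and [u v], which is [u] times
    the gcd of [u], [b] and [v]. *)
Lemma coprime_mul_sqr u v b : coprime u v -> u * v = b ^ 2 -> exists a, u = a ^ 2.
Proof.
move=> cuv uvb; exists (gcdn u b); apply/esym; rewrite expnS expn1.
rewrite muln_gcdl muln_gcdr muln_gcdr -/(b ^ 2).
have -> : b * b = v * u by rewrite mulnC uvb expnS expn1.
rewrite (mulnC b u) -gcdnA [gcdn (u * b) (gcdn _ _)]gcdnA gcdnn [v * u]mulnC.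
by rewrite -!muln_gcdr gcdnC -gcdnA (gcdnC v) (eqP cuv) gcdn1 muln1.
Qed.

(** Both sums of squares are four times a norm, so this passes from norm [2 ^ (2 * m)] to norm
    [2 ^ m]. *)
Lemma descent (p a b m : nat) : prime p -> odd p -> odd a -> odd b ->
  a ^ 2 + p * b ^ 2 = 2 ^ (2 * m.+1) ->
  exists s r : nat, [/\ odd s, odd r & s ^ 2 + p * r ^ 2 = 2 ^ m.+2].
Proof.
move=> pp op oa ob; rewrite [2 * _]mulnC expnM.
set q := 2 ^ m.+1 => E.
have b0 : 0 < p * b ^ 2 by rewrite muln_gt0 prime_gt0 // expn_gt0 odd_gt0.
have lt : a < q by rewrite -(@ltn_exp2r _ _ 2) // -E -[X in X < _]addn0 ltn_add2l.
have q2 : 2 ^ m.+2 = 2 * q by rewrite expnS.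
have oq : ~~ odd q by rewrite /q oddX.
have uw : (q - a) * (q + a) = p * b ^ 2 by rewrite -subn_sqr -E addKn.
have ou : odd (q - a) by rewrite oddB ?(ltnW lt) // oa (negbTE oq).
(* A common divisor divides the sum [2 * q], a power of 2, while [q - a] is odd. *)
have cuw : coprime (q - a) (q + a).
  have -> : q + a = 2 * q - (q - a) by lia.
  have le : q - a <= 2 * q by lia.
  rewrite /coprime -(gcdnDr (q - a)) subnK //.
  by rewrite -q2; apply: coprimeXr; rewrite coprimen2.
have ow : odd (q + a) by rewrite oddD oa (negbTE oq).
(* The factor divisible by [p] becomes [p * r ^ 2] and the other [s ^ 2]; their sum is
   [2 * q = 2 ^ m.+2]. *)
have split u w : coprime u w -> odd u -> odd w ->
    u + w = 2 * q -> u * w = p * b ^ 2 -> p %| u ->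
    exists s r : nat, [/\ odd s, odd r & s ^ 2 + p * r ^ 2 = 2 ^ m.+2].
  move=> cu odu odw sum prod /dvdnP[k uk].
  have kw : k * w = b ^ 2.
    by apply/eqP; rewrite -(eqn_pmul2l (prime_gt0 pp)) -prod uk mulnCA mulnA.
  have ck : coprime k w by apply: coprime_dvdl cu; rewrite uk dvdn_mulr.
  have [r kr] := coprime_mul_sqr ck kw.
  have [s ws] : exists s, w = s ^ 2.
    by apply: (@coprime_mul_sqr w k b); rewrite 1?coprime_sym // mulnC.
  exists s, r; split; first by move: odw; rewrite ws oddX.
    by move: odu; rewrite uk oddM kr oddX => /andP[].
  by rewrite q2 -sum uk kr ws addnC mulnC.
have : p %| (q - a) * (q + a) by rewrite uw dvdn_mulr.
rewrite Euclid_dvdM // => /orP[] d.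
- by apply: (split (q - a) (q + a)) => //; lia.
by apply: (split (q + a) (q - a)); rewrite 1?coprime_sym //; [lia|rewrite mulnC].
Qed.

Local Open Scope ring_scope.

(** * Products of ideals *)

Lemma ideal_mul_mem (I J : algC -> Prop) x y : I x -> J y -> ideal_mul I J (x * y).
Proof. by exists 1%N, (fun=> x), (fun=> y); split=> //; rewrite big_ord1. Qed.

Lemma ideal_mul_ind (I J K : algC -> Prop) :
  K 0 -> (forall x y, K x -> K y -> K (x + y)) ->
  (forall x y, I x -> J y -> K (x * y)) -> forall z, ideal_mul I J z -> K z.
Proof.
by move=> K0 KD KM _ [n [a [b [Ia Jb ->]]]]; apply: big_ind => // i _; apply: KM.
Qed.

Lemma ideal_mulD (I J : algC -> Prop) x y :
  ideal_mul I J x -> ideal_mul I J y -> ideal_mul I J (x + y).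
Proof.
move=> [m [a [b [Ia Jb ->]]]] [n [a' [b' [Ia' Jb' ->]]]].
exists (m + n)%N, (fun i => match split i with inl j => a j | inr j => a' j end),
  (fun i => match split i with inl j => b j | inr j => b' j end).
split=> [i|i|]; [by case: (split i)|by case: (split i)|].
rewrite big_split_ord /=; congr (_ + _); apply: eq_bigr => i _.
  by rewrite (unsplitK (inl i)).
by rewrite (unsplitK (inr i)).
Qed.

(** * Powers of the prime [(2, theta)] in [Z[theta]] *)

Section QuadraticRing.

Variables (theta : algC) (c : int).
Hypothesis theta_sqr : theta * theta = theta - 2 * c%:~R.
Hypothesis theta_conj : theta^* = 1 - theta.
Hypothesis c_gt0 : 0 < c.

(** This is [Z[theta]], of discriminant [1 - 8 c]; for [8 c = p + 1] it is the maximal order. *)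
Definition qring (z : algC) : Prop := exists x y : int, z = x%:~R + y%:~R * theta.

Lemma qring_int n : qring n%:~R.
Proof. by exists n, 0; rewrite mul0r addr0. Qed.

Lemma qring_theta : qring theta.
Proof. by exists 0, 1; rewrite mul1r add0r. Qed.

Lemma qringD z w : qring z -> qring w -> qring (z + w).
Proof.
by move=> [x [y ->]] [x' [y' ->]]; exists (x + x'), (y + y'); rewrite !intrD; ring.
Qed.

Lemma qring_mulE (x y x' y' : int) :
  (x%:~R + y%:~R * theta) * (x'%:~R + y'%:~R * theta) =
  (x * x' - 2 * c * y * y')%:~R + (x * y' + y * x' + y * y')%:~R * theta.
Proof.
transitivity (x%:~R * x'%:~R + (x%:~R * y'%:~R + y%:~R * x'%:~R) * theta
  + y%:~R * y'%:~R * (theta * theta)); first by ring.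
by rewrite theta_sqr; ring.
Qed.

Lemma qringM z w : qring z -> qring w -> qring (z * w).
Proof. by move=> [x [y ->]] [x' [y' ->]]; rewrite qring_mulE; do 2!eexists. Qed.

Lemma qring_conjE (x y : int) :
  (x%:~R + y%:~R * theta)^* = (x + y)%:~R + (- y)%:~R * theta.
Proof. by rewrite rmorphD rmorphM !rmorph_int /= theta_conj; ring. Qed.

Lemma qring_conj z : qring z -> qring z^*.
Proof. by move=> [x [y ->]]; rewrite qring_conjE; do 2!eexists. Qed.

Lemma qring_normE (x y : int) :
  (x%:~R + y%:~R * theta) * (x%:~R + y%:~R * theta)^* =
  (x * x + x * y + 2 * c * y * y)%:~R.
Proof.
by rewrite qring_conjE qring_mulE -[RHS]addr0; congr (_%:~R + _); [ring|ring].
Qed.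

(** Subtracting the conjugate equation leaves [(y - y') (2 theta - 1) = 0], and [2 theta - 1] has
    the nonzero square [1 - 8 c]. *)
Lemma qring_inj (x y x' y' : int) :
  x%:~R + y%:~R * theta = x'%:~R + y'%:~R * theta -> x = x' /\ y = y'.
Proof.
move=> e; have e2 := congr1 (fun z => z^*) e; rewrite !qring_conjE in e2.
suff yy : y = y' by move: e; rewrite yy => /addIr /intr_inj.
have d : (y - y')%:~R * (2 * theta - 1) = 0.
  transitivity ((x%:~R + y%:~R * theta) - (x'%:~R + y'%:~R * theta)
     - ((x + y)%:~R + (- y)%:~R * theta - ((x' + y')%:~R + (- y')%:~R * theta))).
    by ring.
  by rewrite e e2 !subrr.
have t0 : 2 * theta - 1 != 0.
  apply/eqP => t0; have : (2 * theta - 1) * (2 * theta - 1) = (1 - 8 * c)%:~R :> algC.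
    transitivity (4 * (theta * theta) - 4 * theta + 1); first by ring.
    by rewrite theta_sqr; ring.
  by rewrite t0 mul0r => /esym/eqP; rewrite intr_eq0; lia.
by move/eqP: d; rewrite mulf_eq0 (negbTE t0) orbF intr_eq0 subr_eq0 => /eqP.
Qed.

Lemma qring_scale_inj (n x y : int) w :
  qring w -> x%:~R + y%:~R * theta = n%:~R * w -> (n %| x)%Z /\ (n %| y)%Z.
Proof.
move=> [s [t ->]] e; have [-> ->] : x = n * s /\ y = n * t.
  by apply: qring_inj; rewrite e; ring.
by rewrite !dvdz_mulr.
Qed.

(** Modulo 2, [theta ^ 2 = theta], so every positive power is congruent to [theta]; in particular 2
    never divides it. *)
Lemma theta_exp n :
  exists u v : int, theta ^+ n.+1 = (2 * u)%:~R + (2 * v + 1)%:~R * theta.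
Proof.
elim: n => [|n [u [v IH]]]; first by exists 0, 0; rewrite expr1; ring.
exists (- c * (2 * v + 1)), (u + v); rewrite exprSr IH.
transitivity (((2 * u)%:~R + (2 * v + 1)%:~R * theta) * (0%:~R + 1%:~R * theta)).
  by ring.
by rewrite qring_mulE; congr (_%:~R + _%:~R * _); ring.
Qed.

Variables (p : nat) (P : algC -> Prop).
Hypothesis quad_intE : forall z, quad_int p z <-> qring z.
(** Since [theta ^ 2 = theta - 2 c], the lattice spanned by 2 and [theta] is already the ideal
    [(2, theta)]. *)
Hypothesis primeE : forall z,
  P z <-> exists x y : int, z = (2 * x)%:~R + y%:~R * theta.

Let I n := ideal_exp p P n.

Lemma prime_qring z : P z -> qring z.
Proof. by move/primeE => [x [y ->]]; do 2!eexists. Qed.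

Lemma ideal_exp_ideal n :
  [/\ forall z, I n z -> qring z, I n 0, forall z w, I n z -> I n w -> I n (z + w)
    & forall a z, qring a -> I n z -> I n (a * z)].
Proof.
elim: n => [|n [IO I0 ID IM]].
  split=> [z /quad_intE //||z w /quad_intE Oz /quad_intE Ow|a z Oa /quad_intE Oz].
  - exact/quad_intE/(qring_int 0).
  - by apply/quad_intE; apply: qringD.
  - by apply/quad_intE; apply: qringM.
split=> [|||a].
- apply: ideal_mul_ind; [exact: (qring_int 0)|exact: qringD|].
  by move=> x y /prime_qring Ox /IO; apply: qringM.
- rewrite -(mul0r 0); apply: ideal_mul_mem => //; apply/primeE.
  by exists 0, 0; rewrite mulr0 mul0r addr0.
- by move=> z w; apply: ideal_mulD.
- move=> z Oa; move: z; apply: ideal_mul_ind.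
  + rewrite mulr0 -(mul0r 0); apply: ideal_mul_mem => //; apply/primeE.
    by exists 0, 0; rewrite mulr0 mul0r addr0.
  + by move=> z w; rewrite mulrDr; apply: ideal_mulD.
  + move=> x y Px Iy; rewrite mulrCA; apply: ideal_mul_mem => //; exact: IM.
Qed.

Lemma prime_exp z n : P z -> I n (z ^+ n).
Proof.
move=> Pz; elim: n => [|n IH]; first exact/quad_intE/(qring_int 1).
by rewrite exprS; apply: ideal_mul_mem.
Qed.

Lemma prime2 : P 2.
Proof. by apply/primeE; exists 1, 0; ring. Qed.

Lemma prime_theta : P theta.
Proof. by apply/primeE; exists 0, 1; ring. Qed.

(* [P] times its conjugate lies in [2 O], so [P ^ n] times the [n]-th power of the
   conjugate of [P] lies in [2 ^ n O]. *)
Lemma ideal_exp_conj n z q :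
  I n z -> P q -> exists2 w, qring w & z * q^* ^+ n = 2 ^+ n * w.
Proof.
move=> Iz /primeE[x [y ->]]; rewrite qring_conjE.
elim: n z Iz => [|n IH] z; first by move=> /quad_intE Oz; exists z => //; rewrite mulrC.
move: z; apply: ideal_mul_ind => [|z w [z' Oz ez] [w' Ow ew]|a b].
- by exists 0; [exact: (qring_int 0)|rewrite mul0r mulr0].
- by exists (z' + w'); [exact: qringD|rewrite mulrDl ez ew mulrDr].
move=> /primeE[x' [y' ->]] /IH[w Ow ew].
(* The coefficients are half the coordinates of [2 x' + y' theta] times the conjugate of
   [2 x + y theta]. *)
exists ((2 * x' * x + x' * y + c * y * y')%:~R * w + (- x' * y + y' * x)%:~R * theta * w).
  by apply: qringD; apply: qringM => //; [exact: qring_int|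
     apply: qringM; [exact: qring_int|exact: qring_theta]].
rewrite exprS mulrACA ew qring_mulE exprS; ring.
Qed.

(** The witness is a generator [g = x + y theta]. Its norm [N] and [2 ^ n.+1] divide each other, and
    an even [g] would make [theta ^ n.+1] even. *)
Lemma principal_norm n :
  ideal_class_eq p (I n.+1) (quad_int p) ->
  exists x y : int, [/\ ~~ (2 %| y)%Z & x * x + x * y + 2 * c * y * y = 2 ^+ n.+1].
Proof.
move=> [a [b [[_ /eqP a0] _ ab]]].
have [IO I0 ID IM] := ideal_exp_ideal n.+1.
(* Testing the class equality on 1 gives [b = a g]; cancelling [a], every member of [I n.+1] is a
   multiple of [g]. *)
have [g Ig eb] : exists2 g, I n.+1 g & b = a * g.
  apply/ab; exists 1; last by rewrite mulr1.
  exact/quad_intE/(qring_int 1).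
have div z : I n.+1 z -> exists2 w, qring w & z = g * w.
  move=> Iz; have [w /quad_intE Ow e] : exists2 w, quad_int p w & a * z = b * w.
    by apply/ab; exists z.
  by exists w => //; apply: (mulfI a0); rewrite e eb mulrA.
have [x [y eg]] := IO _ Ig; exists x, y; set N := (X in X = _).
have gN : g * g^* = N%:~R by rewrite eg qring_normE.
have [w1 O1 e1] := div _ (prime_exp n.+1 prime2).
have [w2 O2 e2] := div _ (prime_exp n.+1 prime_theta).
have [u [v uv]] := theta_exp n.
have e2n : (2 ^+ n.+1)%:~R = 2 ^+ n.+1 :> algC by rewrite rmorphXn.
have conj2 : (2 ^+ n.+1)^* = 2 ^+ n.+1 :> algC by rewrite -e2n rmorph_int.
have N0 : 0 <= N.
  have : 4 * N = (2 * x + y) * (2 * x + y) + (8 * c - 1) * (y * y) by rewrite /N; ring.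
  have : 0 <= (2 * x + y) * (2 * x + y) by rewrite -expr2 sqr_ge0.
  have : 0 <= (8 * c - 1) * (y * y) by rewrite mulr_ge0 -?expr2 ?sqr_ge0 //; lia.
  by lia.
(* [N] divides [2 ^ n.+1 theta ^ n.+1] and [4 ^ n.+1], and the [theta]-coordinate
   of [theta ^ n.+1] is odd; conversely [2 ^ n.+1] divides [N theta ^ n.+1]. *)
have d1 : (N %| 2 ^+ n.+1 * (2 * v + 1))%Z.
  apply: (qring_scale_inj (n := N) (w := w1^* * w2) (x := 2 ^+ n.+1 * (2 * u)) _ _).2.
    by apply: qringM => //; apply: qring_conj.
  transitivity ((2 ^+ n.+1)^* * theta ^+ n.+1).
    by rewrite conj2 -e2n uv; ring.
  by rewrite {1}e1 e2 rmorphM -gN /=; ring.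
have d2 : (N %| 2 ^+ n.+1 * 2 ^+ n.+1)%Z.
  apply: (qring_scale_inj (n := N) (w := w1^* * w1) (y := 0) _ _).1.
    by apply: qringM => //; apply: qring_conj.
  transitivity ((2 ^+ n.+1)^* * 2 ^+ n.+1 : algC).
    by rewrite conj2 -e2n; ring.
  by rewrite e1 rmorphM -gN /=; ring.
have d3 : (2 ^+ n.+1 %| N * (2 * v + 1))%Z.
  have [w Ow ew] := ideal_exp_conj Ig prime_theta.
  apply: (qring_scale_inj (n := 2 ^+ n.+1) (w := w^* * g) (x := N * (2 * u)) _ _).2.
    by apply: qringM; [apply: qring_conj|exact: IO].
  transitivity (N%:~R * theta ^+ n.+1); first by rewrite uv; ring.
  have ew' : g^* * theta ^+ n.+1 = 2 ^+ n.+1 * w^*.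
    by rewrite -[theta]conjCK -rmorphXn -rmorphM ew rmorphM /= conj2.
  by rewrite -gN -mulrA ew' e2n; ring.
have ov k : coprimez (2 ^+ k) (2 * v + 1).
  by rewrite coprimezE abszX coprimeXl // coprime2n; lia.
(* By [d2], [N] divides a power of 2, so the odd factor [2 v + 1] cancels from both [d1] and
   [d3]. *)
have Ne : N = 2 ^+ n.+1.
  rewrite Gauss_dvdzl // in d3; rewrite Gauss_dvdzl in d1; last first.
    by apply: coprimez_dvdl d2 _; rewrite -exprD; exact: ov.
  have abs : `|N|%N = `|2 ^+ n.+1 : int|%N.
    by apply/eqP; rewrite eqn_dvd; apply/andP.
  by rewrite -(gez0_abs N0) abs gez0_abs // exprn_ge0.
(* If [y] is even, the norm makes [x] even, so 2 divides [g] and hence [theta ^ n.+1]. *)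
split=> //; apply/negP => /dvdzP[k yk].
have [j xj] : exists j, x = 2 * j.
  have : x * x = 2 * (2 ^+ n - x * k - 2 * c * k * y).
    have := Ne; rewrite /N exprS yk => E.
    transitivity (x * x + x * (k * 2) + 2 * c * (k * 2) * (k * 2)
      - (x * (k * 2) + 2 * c * (k * 2) * (k * 2))); first by ring.
    by rewrite E; ring.
  move=> xx; have : (2 %| x * x)%Z by rewrite xx dvdz_mulr.
  by rewrite dvdzE abszM Euclid_dvdM // orbb => /dvdzP[j ->]; exists j; rewrite mulrC.
have : (2 %| 2 * v + 1)%Z.
  apply: (qring_scale_inj (n := 2) (w := (j%:~R + k%:~R * theta) * w2) (x := 2 * u) _ _).2.
    by apply: qringM => //; do 2!eexists.
  by rewrite -uv e2 eg xj yk; ring.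
lia.
Qed.

(** With [y] odd, 2 does not divide [x + y theta], which therefore cannot mix [P] with its
    conjugate: it or its conjugate generates the power of [P]. *)
Lemma norm_principal n (x y : int) :
  ~~ (2 %| y)%Z -> x * x + x * y + 2 * c * y * y = 2 ^+ n.+1 ->
  ideal_class_eq p (I n.+1) (quad_int p).
Proof.
(* Conjugation maps [(x, y)] to [(x + y, - y)]; as [y] is odd, it makes an odd first coordinate
   even. *)
wlog ex : x y / (2 %| x)%Z.
  move=> W oy e; have [ex|ox] := boolP (2 %| x)%Z; first exact: W ex oy e.
  apply: (W (x + y) (- y)); [lia|by rewrite dvdzE abszN -dvdzE|rewrite -e; ring].
case/dvdzP: ex => [k ->] oy {x} norm.
have [IO I0 ID IM] := ideal_exp_ideal n.+1.
pose b := (k * 2)%:~R + y%:~R * theta.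
have Pb : P b by apply/primeE; exists k, y; rewrite /b mulrC.
have bN : b * b^* = 2 ^+ n.+1 by rewrite qring_normE norm rmorphXn.
have Ob := prime_qring Pb.
pose q := 1 - b^*.
have Pq : P q.
  have [j yj] : exists j, y = 2 * j + 1 by exists (y %/ 2)%Z; lia.
  apply/primeE; exists (- k - j), y.
  by rewrite /q qring_conjE yj; ring.
(* [b^*] and [q] are comaximal, and so are [b^*] and [q ^ n.+1]. *)
have [A OA eA] : exists2 A, qring A & 1 - q ^+ n.+1 = b^* * A.
  elim: n.+1 => [|m [A OA eA]].
    by exists 0; [exact: (qring_int 0)|rewrite subrr mulr0].
  exists (A * q + 1).
    apply: qringD; last exact: (qring_int 1).
    by apply: qringM => //; apply: prime_qring.
  rewrite mulrDr mulrA -eA exprSr /q; ring.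
(* As [b] times its conjugate is [2 ^ n.+1], [b] is a combination of the [n.+1]-st powers of [q] and
   2, both in [P]. *)
have Ib : I n.+1 b.
  have -> : b = b * q ^+ n.+1 + A * 2 ^+ n.+1.
    transitivity (b * q ^+ n.+1 + b * (1 - q ^+ n.+1)); first by ring.
    by rewrite eA -bN; ring.
  by apply: ID; apply: IM => //; apply: prime_exp => //; exact: prime2.
exists 1, b; split.
- by split; [exact/quad_intE/(qring_int 1)|exact/eqP/oner_neq0].
- split; first exact/quad_intE.
  by move=> b0; move: bN; rewrite b0 mul0r => /esym/eqP; rewrite expf_eq0 pnatr_eq0.
move=> x; split=> [[z Iz ->]|[z /quad_intE Oz ->]]; last first.
  by exists (z * b); [exact: IM|rewrite mul1r mulrC].
rewrite mul1r.
(* Split [z] as [z q^* ^+ n.+1] plus [z b A^*]: the first term is a multiple of [2 ^ n.+1], hence of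
   [b]. *)
have [w Ow ew] := ideal_exp_conj Iz Pq.
have eA' : 1 - q^* ^+ n.+1 = b * A^*.
  by rewrite -[b]conjCK -rmorphM -eA [RHS]rmorphB rmorph1 rmorphXn.
exists (b^* * w + z * A^*).
  apply/quad_intE; apply: qringD; apply: qringM => //; try exact: qring_conj.
  exact: IO.
transitivity (b * b^* * w + z * (b * A^*)); last by ring.
by rewrite bN -ew -eA'; ring.
Qed.

End QuadraticRing.

(** * Integers of Q(sqrt(-p)) and the prime above 2 *)

(** In lowest terms the square of the denominator divides the prime [p], so the denominator is 1. *)
Lemma rat_int_of_prime_mul_sqr (p : nat) (r : rat) (m : int) :
  prime p -> p%:R * r ^+ 2 = m%:~R -> r \is a Num.int.
Proof.
move=> pp e.
have e2 : p%:Z * numq r ^+ 2 = m * denq r ^+ 2.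
  apply: (@intr_inj rat); transitivity (m%:~R * (denq r)%:~R ^+ 2 : rat); last by ring.
  rewrite -e -{2}(divq_num_den r).
  by field; rewrite intr_eq0 denq_neq0.
have d2 : (`|denq r| ^ 2 %| p)%N.
  rewrite -(@Gauss_dvdl _ p (`|numq r| ^ 2)).
    have := congr1 absz e2; rewrite !expr2 !abszM !mulnn /= => ->; exact: dvdn_mull.
  by rewrite coprimeXl // coprimeXr // coprime_sym coprime_num_den.
have d1 : `|denq r|%N = 1%N.
  have dp : (`|denq r| %| p)%N by apply: dvdn_trans d2; rewrite expnS dvdn_mulr.
  have /primeP[_ H] := pp; have /orP[/eqP //|/eqP dp'] := H _ dp.
  move: d2; rewrite dp' -[X in (_ %| X)%N]expn1 dvdn_Pexp2l // prime_gt1 //.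
by rewrite Qint_def; have := denq_gt0 r; lia.
Qed.

Lemma conj_sqrtC_opp (n : nat) : (0 < n)%N ->
  (sqrtC (- n%:R : algC))^* = - sqrtC (- n%:R).
Proof.
move=> n0; set s := sqrtC _; have s2 : s ^+ 2 = - n%:R by rewrite sqrtCK.
have /eqP : s^* ^+ 2 = s ^+ 2 by rewrite -rmorphXn s2 rmorphN /= rmorph_nat.
rewrite eqf_sqr => /orP[/eqP sr|/eqP //].
have /CrealP/real_exprn_even_ge0 := sr.
by move=> /(_ 2%N isT); rewrite s2 oppr_ge0 lern0; case: (n) n0.
Qed.

(** Both signs are allowed because it is not known in advance which of the two roots lies in the
    given prime ideal. *)
Lemma quad_gen_sqr (p : nat) (c : int) (theta : algC) :
  p%:Z + 1 = 8 * c ->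
  2 * theta - 1 = sqrtC (- p%:R) \/ 2 * theta - 1 = - sqrtC (- p%:R) ->
  theta * theta = theta - 2 * c%:~R.
Proof.
move=> pc th; set s := sqrtC _ in th.
have s2 : s ^+ 2 = - p%:R by rewrite sqrtCK.
have pC : p%:R = 8 * c%:~R - 1 :> algC.
  transitivity ((p%:Z + 1 - 1)%:~R : algC); first by rewrite addrK.
  by rewrite pc; ring.
have t2 : (2 * theta - 1) ^+ 2 = 1 - 8 * c%:~R.
  by case: th => ->; rewrite ?sqrrN s2 pC; ring.
transitivity (((2 * theta - 1) ^+ 2 + 4 * theta - 1) / 4); first by field.
by rewrite t2; field.
Qed.

Lemma quad_gen_Aint (c : int) (theta : algC) :
  theta * theta = theta - 2 * c%:~R -> theta \in Aint.
Proof.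
move=> t2; pose q : {poly algC} := 'X * ('X - 1%:P) + (2 * c%:~R)%:P.
have sq : size ('X * ('X - 1%:P) : {poly algC}) = 3.
  by rewrite size_Mmonic ?polyX_eq0 ?monicXsubC // size_polyX size_XsubC.
apply: (@root_monic_Aint q).
- by rewrite /root !hornerE mulrBr t2; apply/eqP; ring.
- rewrite monicE lead_coefDl ?sq; last by rewrite size_polyC; case: (_ != 0).
  by rewrite -monicE rpredM ?monicX ?monicXsubC.
suff : q \is a polyOver Num.int_num_subdef by [].
by rewrite /q rpredD ?rpredM ?rpredB ?polyOverX ?polyOverC ?rpred1 ?rpredM
  ?rpred_nat ?rpred_int.
Qed.

(** For an integral [z = a + b s], the trace makes [2 a] an integer, and the squared difference of
    [z] and its conjugate makes [p (2 b) ^ 2], hence [2 b], one. The norm then fixes the parity. *)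
Lemma quad_intP (p : nat) (c : int) (theta : algC) z :
  prime p -> p%:Z + 1 = 8 * c ->
  2 * theta - 1 = sqrtC (- p%:R) \/ 2 * theta - 1 = - sqrtC (- p%:R) ->
  quad_int p z <-> qring theta z.
Proof.
move=> pp pc th; set s := sqrtC _ in th.
have s2 : s ^+ 2 = - p%:R by rewrite sqrtCK.
have pC : p%:R = 8 * c%:~R - 1 :> algC.
  transitivity ((p%:Z + 1 - 1)%:~R : algC); first by rewrite addrK.
  by rewrite pc; ring.
have sc : s^* = - s by apply: conj_sqrtC_opp; rewrite prime_gt0.
have zc (a b : rat) : (ratr a + ratr b * s)^* = ratr a - ratr b * s.
  by rewrite rmorphD [X in _ + X]rmorphM /= sc !conj_Crat ?Crat_rat // mulrN.
split=> [[[a [b -> {z}]]]|[x [y ->]]]; last first.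
  have thA := quad_gen_Aint (quad_gen_sqr pc th).
  split; last by apply: rpredD; [|apply: rpredM]; rewrite ?Aint_int.
  case: th => e; [exists (x%:~R + y%:~R / 2), (y%:~R / 2)|
                  exists (x%:~R + y%:~R / 2), (- y%:~R / 2)];
    rewrite ?mulNr ?rmorphN rmorphD !fmorph_div /= !ratr_int ?rmorph_nat.
    by rewrite -/s -e; field.
  by rewrite mulNr -mulrN -/s -e; field.
rewrite -/s; set z := _ + _ => zA.
have zcA : z^* \in Aint by rewrite Aint_aut.
have ratA (r : rat) : (ratr r : algC) \in Aint -> exists m : int, r = m%:~R.
  by move=> /(Cint_rat_Aint (Crat_rat r)); rewrite Cint_rat => /intrP.
have [A aA] : exists A : int, 2 * a = A%:~R.
  apply: ratA; rewrite rmorphM /= rmorph_nat.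
  have -> : 2 * ratr a = z + z^* by rewrite zc /z; move: (ratr a) (ratr b) => a' b'; ring.
  exact: rpredD.
have [B bB] : exists B : int, 2 * b = B%:~R.
  apply/intrP.
  suff [m] : exists m : int, p%:R * (2 * b) ^+ 2 = m%:~R.
    exact: rat_int_of_prime_mul_sqr.
  apply: ratA.
  have -> : ratr (p%:R * (2 * b) ^+ 2) = - (z - z^*) ^+ 2 :> algC.
    rewrite rmorphM rmorphXn rmorphM /= !rmorph_nat zc /z; move: (ratr a) (ratr b) => a' b'.
    transitivity (- (4 * b' ^+ 2 * s ^+ 2) : algC); last by ring.
    by rewrite s2; ring.
  by rewrite rpredN rpredX // rpredB.
have [N abN] : exists N : int, a ^+ 2 + p%:R * b ^+ 2 = N%:~R.
  apply: ratA; rewrite rmorphD rmorphM !rmorphXn /= rmorph_nat.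
  have -> : ratr a ^+ 2 + p%:R * ratr b ^+ 2 = z * z^* :> algC.
    rewrite zc /z; move: (ratr a) (ratr b) => a' b'.
    transitivity (a' ^+ 2 - b' ^+ 2 * s ^+ 2); last by ring.
    by rewrite s2; ring.
  exact: rpredM.
have ABN : A * A + p%:Z * B * B = 4 * N.
  apply: (@intr_inj rat); transitivity (4 * (a ^+ 2 + p%:R * b ^+ 2)).
    transitivity (A%:~R ^+ 2 + p%:R * B%:~R ^+ 2 : rat); first by ring.
    by rewrite -aA -bB; ring.
  by rewrite abN; ring.
(* [E] is the [theta]-coordinate, its sign following the choice of [theta];
   [A ^ 2 - B ^ 2 = 4 N - (p + 1) B ^ 2] is even. *)
have even (E : int) : E = B \/ E = - B -> exists x, A = 2 * x + E.
  move=> EB; have : (2 %| (A - E) * (A + E))%Z.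
    have -> : (A - E) * (A + E) = 2 * (2 * N - 4 * c * B * B).
      transitivity (A * A + p%:Z * B * B - (p%:Z + 1) * B * B); last by rewrite ABN pc; ring.
      by case: EB => ->; ring.
    by rewrite dvdz_mulr.
  rewrite dvdzE abszM Euclid_dvdM // -!dvdzE => AE.
  exists ((A - E) %/ 2)%Z; case/orP: AE; lia.
have aC : ratr a = A%:~R / 2 :> algC.
  by rewrite -(ratr_int _ A) -aA rmorphM /= rmorph_nat; field.
have bC : ratr b = B%:~R / 2 :> algC.
  by rewrite -(ratr_int _ B) -bB rmorphM /= rmorph_nat; field.
case: th => e.
  have [x xA] := even B (or_introl erefl); exists x, B.
  by rewrite /z aC bC -e xA; field.
have [x xA] := even (- B) (or_intror erefl); exists x, (- B).
by rewrite /z aC bC -[s]opprK -e xA; field.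
Qed.

(** The roots [t] and [1 - t] have product [2 c] in [P], so primality puts one of them in [P]. *)
Lemma prime_above2 (p : nat) (P : algC -> Prop) (c : int) :
  prime p -> p%:Z + 1 = 8 * c -> is_prime_ideal p P -> P 2 ->
  exists theta,
    [/\ theta * theta = theta - 2 * c%:~R, theta^* = 1 - theta,
        forall z, quad_int p z <-> qring theta z
      & forall z, P z <-> exists x y : int, z = (2 * x)%:~R + y%:~R * theta].
Proof.
move=> pp pc [[PO P0 PD PM] P1 Pprime] P2.
set s := sqrtC (- p%:R : algC).
have sc : s^* = - s by apply: conj_sqrtC_opp; rewrite prime_gt0.
have [theta [Pt th]] : exists theta, P theta /\
    (2 * theta - 1 = s \/ 2 * theta - 1 = - s).
  pose t := (1 + s) / 2.
  have tE : 2 * t - 1 = s by rewrite /t; field.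
  have tE' : 2 * (1 - t) - 1 = - s by rewrite /t; field.
  have Ot : quad_int p t.
    by apply/(quad_intP t pp pc (or_introl tE)); apply: qring_theta.
  have Ot' : quad_int p (1 - t).
    by apply/(quad_intP _ pp pc (or_intror tE')); apply: qring_theta.
  have Pt1 : P (t * (1 - t)).
    rewrite mulrBr mulr1 (quad_gen_sqr pc (or_introl tE)).
    have -> : t - (t - 2 * c%:~R) = c%:~R * 2 by ring.
    by apply: PM => //; apply/(quad_intP _ pp pc (or_introl tE)); apply: qring_int.
  have [Pt|Pt] := Pprime t (1 - t) Ot Ot' Pt1.
  - by exists t; split=> //; left.
  - by exists (1 - t); split=> //; right.
have OE z := quad_intP z pp pc th.
exists theta; split=> //; first exact: quad_gen_sqr pc th.
  have -> : theta = (2 * theta - 1 + 1) / 2 by field.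
  rewrite fmorph_div rmorphD rmorph1 rmorph_nat /=.
  by case: th => ->; rewrite ?rmorphN /= sc; field.
move=> z; split=> [Pz|[x [y ->]]]; last first.
  apply: PD; last by apply: PM => //; apply/OE/qring_int.
  by rewrite mulrC intrM; apply: PM => //; apply/OE/qring_int.
have /OE[x [y ez]] := PO _ Pz.
(* With [x] odd, subtracting multiples of [theta] and 2 from [z] would put 1 in [P]. *)
have [/dvdzP[k xk]|ox] := boolP (2 %| x)%Z.
  by exists k, y; rewrite ez xk mulrC.
case: P1.
have -> : 1 = z + (- y)%:~R * theta + (- (x %/ 2)%Z)%:~R * 2.
  have x2 : x = 2 * (x %/ 2)%Z + 1 by lia.
  by rewrite ez {1}x2; ring.
by apply: (PD); [apply: PD => //|]; apply: PM => //; apply/OE/qring_int.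
Qed.

(** * Oddness of the class order *)

Lemma class_order_odd (p : nat) (P : algC -> Prop) (L : nat) (c : int) :
  prime p -> p%:Z + 1 = 8 * c -> is_prime_ideal p P -> P 2 ->
  is_class_order p P L -> odd L.
Proof.
move=> pp pc hP P2 [L0 LO Lmin]; apply/negPn/negP => eL.
have [[|m] Lm] : exists m, L = (2 * m)%N by exists L./2; lia.
  by move: L0; rewrite Lm.
have [theta [t2 tc OE PE]] := prime_above2 pp pc hP P2.
have c0 : 0 < c by lia.
have [x [y [oy norm]]] : exists x y : int,
    ~~ (2 %| y)%Z /\ x * x + x * y + 2 * c * y * y = 2 ^+ L.
  have Lp : L = L.-1.+1 by lia.
  rewrite Lp; rewrite Lp in LO.
  exact: (principal_norm t2 tc c0 OE PE LO).
have sqz (z : int) : (`|z| ^ 2)%N%:Z = z * z.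
  by rewrite -mulnn PoszM !abszE -normrM ger0_norm // -expr2 sqr_ge0.
have powz k : (2 ^ k)%N%:Z = 2 ^+ k by rewrite -!natz natrX.
(* Four times the norm of [x + y theta] is [(2 x + y) ^ 2 + p y ^ 2], so the exponent is
   [L + 2 = 2 * m.+2]. *)
have [|||||s [r [os or sr]]] := @descent p `|(2 * x + y)%R|%N `|y|%N m.+1 => //.
- lia.
- lia.
- lia.
- apply/eqP; rewrite -eqz_nat PoszD PoszM !sqz powz; apply/eqP.
  transitivity (4 * (x * x + x * y + 2 * c * y * y) + (p%:Z + 1 - 8 * c) * y * y).
    by ring.
  rewrite norm pc (_ : 2 * m.+2 = 2 + L)%N; last by rewrite Lm; lia.
  by rewrite exprD; ring.
suff : (L <= m.+1)%N by lia.
apply: Lmin => //.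
(* The square is completed backwards: [k + r theta] has norm [2 ^ m.+1], where [m.+1] is half of
   [L]. *)
pose k := ((s%:Z - r%:Z) %/ 2)%Z; have sk : s%:Z = 2 * k + r%:Z by lia.
apply: (norm_principal t2 tc c0 OE PE (x := k) (y := r%:Z)); first by lia.
apply: (@mulfI _ (4 : int)) => //.
have srz : s%:Z * s%:Z + p%:Z * r%:Z * r%:Z = 4 * 2 ^+ m.+1.
  have := congr1 Posz sr; rewrite PoszD PoszM powz -!mulnn !PoszM mulrA => ->.
  by rewrite !exprS; ring.
rewrite -srz sk.
transitivity ((2 * k + r%:Z) * (2 * k + r%:Z) + (8 * c - 1) * r%:Z * r%:Z).
  by ring.
by rewrite -pc addrK.
Qed.
Local Close Scope ring_scope.

(** * Lower bounds from Lipschitz potentials *)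

(** The potentials are glued by shifting [h2] by [h1 v1 + 1]; as [h2 v2 = 0], the new edge changes
    the value by exactly one. *)
Lemma dist_join_ge (T1 T2 : finType) (E1 : {set {set T1}}) (E2 : {set {set T2}})
    v1 v2 (h1 : T1 -> nat) (h2 : T2 -> nat) a b :
  (forall u v, adj E1 u v -> h1 v <= (h1 u).+1) ->
  (forall u v, adj E2 u v -> h2 v <= (h2 u).+1) ->
  h1 a = 0 -> h2 v2 = 0 -> h1 v1 + h2 b < #|T1| + #|T2| ->
  h1 v1 + h2 b < dist (join_edges E1 E2 v1 v2) (inl a) (inr b).
Proof.
move=> l1 l2 h1a h2v small.
pose h z := match z with inl u => h1 u | inr u => (h1 v1 + h2 u).+1 end.
have := @dist_ge _ (join_edges E1 E2 v1 v2) h (inl a) (inr b); rewrite /= h1a !add0n.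
apply; last by rewrite card_sum.
case=> [u|u] [v|v]; rewrite ?adj_join_ll ?adj_join_rr /=.
- exact: l1.
- by rewrite adj_join_lr => /andP[/eqP -> /eqP ->]; rewrite h2v addn0.
- by rewrite adj_sym adj_join_lr => /andP[/eqP -> /eqP ->]; rewrite h2v; lia.
- by move/l2; lia.
Qed.

(** [h] is the distance from an end of the component: vertex 0 if [v > n], vertex [2 * n] otherwise.
    The upper bound on [h v] serves the size condition of [dist_join_ge]. *)
Lemma folded_potential L n (v : 'I_L) : L = 2 * n + 1 -> folded_floor v ->
  exists (h : 'I_L -> nat) (a : 'I_L),
    [/\ forall x y, adj (folded_edges L) x y -> h y <= (h x).+1,
        h a = 0 & n + 3 <= 2 * h v <= 2 * (n + 1)].
Proof.
move=> Ln /andP[v0 ev]; have vL := ltn_ord v.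
have [near|far] := leqP v n; last first.
  have L0 : 0 < L by lia.
  exists (fun x => if x == 0 :> nat then 0 else x./2.+1), (Ordinal L0).
  split=> //; last by rewrite (negbTE v0); lia.
  move=> x y /folded_edgeP /= xy.
  by case: eqP => ?; case: eqP => ?; case: xy => -[]; lia.
have nL : 2 * n < L by lia.
pose h (x : 'I_L) := if odd x then n - x./2 else
  if x == 0 :> nat then n + 1 else if x == 2 * n :> nat then 0 else n - x./2 + 2.
exists h, (Ordinal nL).
split; rewrite /h /=; last 1 first.
- by rewrite (negbTE ev) (negbTE v0); case: eqP; lia.
- move=> x y /folded_edgeP /= xy; have xL := ltn_ord x; have yL := ltn_ord y.
  by do 6?[case: ifP => ?]; case: xy => -[]; lia.
by rewrite eqxx; do 2?[case: ifP => ?]; lia.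
Qed.

(** With truncated subtraction, [(i - j) + (j - i)] is the absolute difference; the minimum compares
    the two arcs of an [L]-cycle. *)
Definition cycle_dist (L i j : nat) : nat :=
  minn ((i - j) + (j - i)) (L - ((i - j) + (j - i))).

Lemma cycle_distii L i : cycle_dist L i i = 0.
Proof. by rewrite /cycle_dist subnn min0n. Qed.

Lemma leq_minn_succ a b a' b' :
  a' <= a.+1 -> b' <= b.+1 -> minn a' b' <= (minn a b).+1.
Proof. by rewrite -minnSS leq_min !geq_min => -> ->; rewrite orbT. Qed.

Lemma cycle_dist_succ L i j :
  cycle_dist L i.+1 j <= (cycle_dist L i j).+1 /\
  cycle_dist L i j <= (cycle_dist L i.+1 j).+1.
Proof. by split; apply: leq_minn_succ; lia. Qed.

Lemma cycle_dist_wrap L i j : i.+1 = L -> j < L ->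
  cycle_dist L 0 j <= (cycle_dist L i j).+1 /\
  cycle_dist L i j <= (cycle_dist L 0 j).+1.
Proof.
move=> iL jL; rewrite /cycle_dist.
(* Passing from [L - 1] to 0 exchanges the two arcs, hence [minnC]. *)
by split; rewrite minnC; apply: leq_minn_succ; lia.
Qed.

Lemma stacked_potential L n (v : 'I_(2 * L)) : L = 2 * n + 1 -> 0 < n -> stacked_floor v ->
  exists (h : 'I_(2 * L) -> nat) (b : 'I_(2 * L)),
    [/\ forall x y, adj (stacked_edges L) x y -> h y <= (h x).+1,
        h v = 0 & h b = n + 2].
Proof.
rewrite /stacked_floor => Ln n0 ev; have vL := ltn_ord v.
pose arc x := cycle_dist L x./2 v./2.
(* The distance from [v]: one edge to the spine, [arc x] along it, and one more edge to another
   floor vertex. *)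
pose h (x : nat) := if x == v :> nat then 0 else if odd x then (arc x).+1 else (arc x).+2.
have hodd x : odd x -> h x = (arc x).+1.
  by rewrite /h => ox; case: eqP => [xv|_]; [move: ev; rewrite -xv ox|rewrite ox].
have arcv : arc v = 0 by apply: cycle_distii.
(* [b] is the floor vertex [n] spine steps away, at [v + 2 * n] or [v - 2 * n], whichever is in
   range. *)
have [b bL hb] : exists2 b, b < 2 * L & h b = n + 2.
  have [lt|ge] := ltnP v L.
    exists (v + 2 * n); first by lia.
    have half : (v + 2 * n)./2 = v./2 + n by lia.
    have ovn : odd (v + 2 * n) = false by lia.
    rewrite /h ovn ifN; last by lia.
    by rewrite /arc half /cycle_dist (minn_idPl _); lia.
  exists (v - 2 * n); first by lia.
  have half : (v - 2 * n)./2 = v./2 - n by lia.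
  have ovn : odd (v - 2 * n) = false by lia.
  rewrite /h ovn ifN; last by lia.
  by rewrite /arc half /cycle_dist (minn_idPl _); lia.
exists (fun x => h x), (Ordinal bL); split=> //; last by rewrite /h eqxx.
move=> x y /stacked_edgeP /=.
have floor a b' : ~~ odd a -> b' = a + 1 -> h b' <= (h a).+1 /\ h a <= (h b').+1.
  move=> ea ->; have same : arc (a + 1) = arc a by rewrite /arc (_ : (a + 1)./2 = a./2) //; lia.
  rewrite hodd ?same; last by lia.
  by rewrite /h (negbTE ea); case: eqP => [->|_]; rewrite ?arcv; split; lia.
have spine a b' : odd a -> b' = a + 2 -> h b' <= (h a).+1 /\ h a <= (h b').+1.
  move=> oa ->; have half : (a + 2)./2 = (a./2).+1 by lia.
  rewrite !hodd //; last by lia.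
  by rewrite !ltnS /arc half; apply: cycle_dist_succ.
have wrap a b' : a = 2 * L - 1 -> b' = 1 -> h b' <= (h a).+1 /\ h a <= (h b').+1.
  move=> -> ->; rewrite !hodd //; last by lia.
  by rewrite !ltnS; apply: cycle_dist_wrap; lia.
by case=> -[[ex ey]|[ox oy]|[wx wy]];
  [case: (floor _ _ ex ey)|case: (spine _ _ ox oy)|case: (wrap _ _ wx wy)
  |case: (floor _ _ ex ey)|case: (spine _ _ ox oy)|case: (wrap _ _ wx wy)].
Qed.

(** * Combination of the two bounds *)

Theorem theorem41 (p : nat) (hp : prime p)
    (hp120 : p = 71 %[mod 120] \/ p = 119 %[mod 120])
    (P : algC -> Prop) (hP : is_prime_ideal p P) (hP2 : P 2%:R%R)
    (L : nat) (hL : is_class_order p P L)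
    (v1 : 'I_L) (hv1 : folded_floor v1)
    (v2 : 'I_(2 * L)) (hv2 : stacked_floor v2) :
  let D := diam (join_edges (folded_edges L) (stacked_edges L) v1 v2) in
  (3%:R / 4%:R * (L%:R + 5%:R) <= D%:R :> rat)%R /\ D <= L + 3.
Proof.
have oL : odd L.
  (* Both residues are 7 modulo 8, so [c = (p + 1) / 8] is exact. *)
  apply: (@class_order_odd p P L (Posz (p.+1 %/ 8))) => //.
  by case: hp120 => ?; lia.
have [n Ln] : exists n, L = 2 * n + 1 by exists L./2; lia.
(* For [n = 0] the only vertex is 0, which is not a floor vertex. *)
have n0 : 0 < n by move: hv1 (ltn_ord v1); rewrite /folded_floor; lia.
move=> D; have [h1 [a [lip1 h1a h1v]]] := folded_potential Ln hv1.
have [h2 [b [lip2 h2v h2b]]] := stacked_potential Ln n0 hv2.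
have lo : h1 v1 + h2 b < D.
  apply: leq_trans (dist_le_diam _ (inl a) (inr b)).
  by apply: dist_join_ge => //; rewrite !card_ord; lia.
split; last first.
  have -> : L + 3 = (n + 1) + (n + 2) + 1 by lia.
  apply: diam_join_le; first by rewrite !card_ord; lia.
    by move=> x y; apply: folded_reach.
  by move=> x y; apply: stacked_reach.
(* From [D >= h1 v1 + n + 3] and [2 * h1 v1 >= n + 3] follows
   [4 * D >= 6 * n + 18 = 3 * (L + 5)]. *)
have lo4 : 3 * (L + 5) <= 4 * D by lia.
rewrite mulrAC ler_pdivrMr // -natrD -!natrM ler_nat; lia.
Qed.
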